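(* Let $\mathbb{F}$ be a field with $\operatorname{char}(\mathbb{F}) \neq 2$. Let $L$ be a non-nilpotent left Leibniz algebra over $\mathbb{F}$ which is not a Lie algebra, with $\dim_{\mathbb{F}} L = n$ (finite) and $\dim_{\mathbb{F}} [L,L] = 1$. Then $L$ is isomorphic, as a Leibniz algebra, to the direct sum of the two-dimensional non-nilpotent non-Lie Leibniz algebra $S_2$ and an abelian algebra of dimension $n-2$.
   Context: A left Leibniz algebra over $\mathbb{F}$ is an $\mathbb{F}$-vector space $L$ with a bilinear map $[-,-]\colon L\times L\to L$ such that $[x,[y,z]]=[[x,y],z]+[y,[x,z]]$ for all $x,y,z\in L$. It is a Lie algebra if moreover $[x,x]=0$ for all $x$. All Leibniz algebras are finite-dimensional. For subspaces $U,V$ of $L$, $[U,V]$ denotes the linear span of all $[u,v]$ with $u\in U$, $v\in V$; $[L,L]$ is the derived subalgebra. $L$ is nilpotent if the lower central series $L^{(0)}=L$, $L^{(k+1)}=[L,L^{(k)}]$ satisfies $L^{(m)}=0$ for some $m$. An abelian algebra is one with zero bracket. The direct sum of two Leibniz algebras is the direct sum of vector spaces with componentwise bracket. $S_2$ is the two-dimensional left Leibniz algebra with basis $\{e_1,e_2\}$ whose only non-zero bracket of basis elements is $[e_2,e_1]=e_1$. *)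

(* Defs.v *)
From HB Require Import structures.
From mathcomp Require Import all_boot all_order all_algebra.

Set Implicit Arguments.
Unset Strict Implicit.
Unset Printing Implicit Defensive.

Import GRing.Theory.
Local Open Scope ring_scope.

HB.mixin Record isLeibniz (F : fieldType) L of Vector F L := {
  bracket : L -> L -> L;
  bracket_linearl : forall y : L, linear (bracket^~ y);
  bracket_linearr : forall x : L, linear (bracket x);
  bracket_leibniz : forall x y z : L,
    bracket x (bracket y z) = bracket (bracket x y) z + bracket y (bracket x z)
}.

#[short(type="leibnizType")]
HB.structure Definition Leibniz (F : fieldType) :=
  { L of isLeibniz F L & Vector F L }.

HB.instance Definition _ (F : fieldType) (L : leibnizType F) :=
  bilinear_isBilinear.Build F L L L *:%R *:%R (@bracket F L)
    (@bracket_linearl F L, @bracket_linearr F L).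

Definition is_lie (F : fieldType) (L : leibnizType F) : Prop :=
  forall x : L, bracket x x = 0.

Definition is_abelian (F : fieldType) (L : leibnizType F) : Prop :=
  forall x y : L, bracket x y = 0.

(* The span of the brackets of basis vectors of U and V; by bilinearity this is
   the span of all [u, v] with u \in U and v \in V, see bracketvP. *)
Definition bracketv (F : fieldType) (L : leibnizType F) (U V : {vspace L}) :
    {vspace L} :=
  <<[seq bracket u v | u <- vbasis U, v <- vbasis V]>>%VS.

Lemma memv_bracket (F : fieldType) (L : leibnizType F) (U V : {vspace L}) :
  {in U & V, forall u v, bracket u v \in bracketv U V}.
Proof.
move=> u v /coord_vbasis-> /coord_vbasis->.
rewrite linear_sumlz; apply: memv_suml => i _.
rewrite linear_sumr; apply: memv_suml => j _ /=.
rewrite linearZl_LR linearZr_LR !memvZ //.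
by apply/memv_span/allpairs_f; exact: memt_nth.
Qed.

Lemma bracketvP (F : fieldType) (L : leibnizType F) (U V W : {vspace L}) :
  reflect {in U & V, forall u v, bracket u v \in W} (bracketv U V <= W)%VS.
Proof.
apply: (iffP idP) => [sW u v Uu Vv | sW].
  by rewrite (subvP sW) ?memv_bracket.
apply/span_subvP=> _ /allpairsP[[u v] /= [Uu Vv ->]].
by rewrite sW ?vbasis_mem.
Qed.

Definition derived (F : fieldType) (L : leibnizType F) : {vspace L} :=
  bracketv fullv fullv.

Fixpoint lower_central (F : fieldType) (L : leibnizType F) (k : nat) :
    {vspace L} :=
  if k is k'.+1 then bracketv fullv (lower_central L k') else fullv.

Definition is_nilpotent (F : fieldType) (L : leibnizType F) : Prop :=
  exists m : nat, lower_central L m = 0%VS.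

Definition leibniz_isomorphic (F : fieldType) (L M : leibnizType F) : Prop :=
  exists f : {linear L -> M},
    bijective f /\ {morph f : x y / bracket x y >-> bracket x y}.

Section DirectSum.
Variables (F : fieldType) (L M : leibnizType F).

Definition sum_bracket (x y : L * M) : L * M :=
  (bracket x.1 y.1, bracket x.2 y.2).

Fact sum_bracket_linearl y : linear (sum_bracket^~ y).
Proof. by move=> a u v; rewrite /sum_bracket /= !linearPl. Qed.

Fact sum_bracket_linearr x : linear (sum_bracket x).
Proof. by move=> a u v; rewrite /sum_bracket /= !linearPr. Qed.

Fact sum_bracket_leibniz x y z :
  sum_bracket x (sum_bracket y z) =
  sum_bracket (sum_bracket x y) z + sum_bracket y (sum_bracket x z).
Proof.
by rewrite /sum_bracket /= [in LHS]bracket_leibniz [X in (_, X)]bracket_leibniz.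
Qed.

HB.instance Definition _ := isLeibniz.Build F (L * M)%type
  sum_bracket_linearl sum_bracket_linearr sum_bracket_leibniz.

End DirectSum.

Definition S2 (F : fieldType) : Type := 'rV[F]_2.

Section S2Leibniz.
Variable F : fieldType.

HB.instance Definition _ := Vector.on (S2 F).

Definition S2_e1 : S2 F := 'e_(0 : 'I_2).
Definition S2_e2 : S2 F := 'e_(1 : 'I_2).

(* The bilinear extension of [e2, e1] = e1, all other brackets of basis vectors
   being zero. *)
Definition S2_bracket (x y : S2 F) : S2 F :=
  ((x : 'rV[F]_2) 0 1 * (y : 'rV[F]_2) 0 0) *: S2_e1.

Fact S2_bracket_linearl y : linear (S2_bracket^~ y).
Proof.
by move=> a u v; rewrite /S2_bracket !mxE mulrDl scalerDl -mulrA scalerA.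
Qed.

Fact S2_bracket_linearr x : linear (S2_bracket x).
Proof.
by move=> a u v; rewrite /S2_bracket !mxE mulrDr scalerDl mulrCA scalerA.
Qed.

Fact S2_bracket_leibniz x y z :
  S2_bracket x (S2_bracket y z) =
  S2_bracket (S2_bracket x y) z + S2_bracket y (S2_bracket x z).
Proof.
rewrite /S2_bracket !mxE /= !(mulr1, mulr0, mul0r, scale0r, add0r).
by rewrite mulrCA.
Qed.

HB.instance Definition _ := isLeibniz.Build F (S2 F)
  S2_bracket_linearl S2_bracket_linearr S2_bracket_leibniz.

Lemma S2_basis : basis_of {:S2 F} [:: S2_e1; S2_e2].
Proof.
have sS : ({:S2 F} <= <<[:: S2_e1; S2_e2]>>)%VS.
  apply/subvP => x _.
  have ->: x = (x : 'rV_2) 0 0 *: S2_e1 + (x : 'rV_2) 0 1 *: S2_e2.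
    rewrite [LHS](row_sum_delta (x : 'rV_2)) !big_ord_recl big_ord0 addr0.
    by congr (_ + _ *: _); rewrite /S2_e2; do ?congr (_ _); apply: val_inj.
  by rewrite memvD // memvZ // memv_span // !inE eqxx ?orbT.
by rewrite basisEdim sS dimvf.
Qed.

Lemma S2_brackets :
  [/\ bracket S2_e1 S2_e1 = 0, bracket S2_e1 S2_e2 = 0,
      bracket S2_e2 S2_e1 = S2_e1 & bracket S2_e2 S2_e2 = 0].
Proof.
by split; rewrite /bracket /= /S2_bracket !mxE /= ?mulr0 ?mul0r ?mulr1 ?scale0r ?scale1r.
Qed.

Lemma S2_e1_neq0 : S2_e1 != 0.
Proof.
apply/eqP => /rowP/(_ 0); rewrite !mxE /= => /eqP.
by rewrite oner_eq0.
Qed.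

Lemma S2_not_lie : ~ is_lie (S2 F).
Proof.
have [b11 b12 b21 b22] := S2_brackets.
move=> /(_ (S2_e1 + S2_e2)); rewrite linearDl /= !linearDr /= b11 b12 b21 b22.
by rewrite !(add0r, addr0); apply/eqP/S2_e1_neq0.
Qed.

Lemma S2_not_nilpotent : ~ is_nilpotent (S2 F).
Proof.
have [_ _ b21 _] := S2_brackets.
have le1 k : S2_e1 \in lower_central (S2 F) k.
  elim: k => [|k IHk] /=; first exact: memvf.
  by rewrite -b21 memv_bracket ?memvf.
case=> m lm0; have := le1 m; rewrite lm0 memv0.
exact/negP/S2_e1_neq0.
Qed.

End S2Leibniz.

(* Main.v *)
(** If [L, L] = <z>, the bracket is [x, y] = phi(x, y) z for a bilinear form phi.
    Squares act trivially from the left, and some square is a non-zero multiple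
    of z as L is not Lie, so [z, -] = 0. The Leibniz identity then reads
    phi(x, z) phi(y, w) = phi(y, z) phi(x, w), and phi(-, z) is non-zero because L
    is not nilpotent; hence phi = a (x) c has rank one, with a(z) = 0 and
    c(z) = 1. Choosing e with a(e) = 1 and c(e) = 0, the pair (z, e) spans a copy
    of S_2 complementary to the abelian ideal ker a :&: ker c. *)
Require Import Defs.
From HB Require Import structures.
From mathcomp Require Import all_boot all_order all_algebra.

Set Implicit Arguments.
Unset Strict Implicit.
Unset Printing Implicit Defensive.

Import GRing.Theory.
Local Open Scope ring_scope.

(** A type alias, so that the zero bracket sits on a copy of [V] and cannot clash with a bracket on
    [V] itself. *)
Definition abelian_on (F : fieldType) (V : vectType F) : Type := V.

Section AbelianLeibniz.
Variables (F : fieldType) (V : vectType F).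

HB.instance Definition _ := Vector.on (abelian_on V).

Definition zero_bracket (_ _ : abelian_on V) : abelian_on V := 0.

Fact zero_bracket_linearl y : linear (zero_bracket^~ y).
Proof. by move=> k u v; rewrite /zero_bracket scaler0 addr0. Qed.

Fact zero_bracket_linearr x : linear (zero_bracket x).
Proof. by move=> k u v; rewrite /zero_bracket scaler0 addr0. Qed.

Fact zero_bracket_leibniz x y z :
  zero_bracket x (zero_bracket y z) =
  zero_bracket (zero_bracket x y) z + zero_bracket y (zero_bracket x z).
Proof. by rewrite /zero_bracket addr0. Qed.

HB.instance Definition _ := isLeibniz.Build F (abelian_on V)
  zero_bracket_linearl zero_bracket_linearr zero_bracket_leibniz.

Lemma abelian_onP : is_abelian (abelian_on V).
Proof. by []. Qed.

End AbelianLeibniz.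

Section LeibnizTheory.
Variables (F : fieldType) (L : leibnizType F).

(* The linear structure of the bare partial application [bracket x] is not
   inferred, hence the named copies. *)
Definition adl (x y : L) : L := bracket x y.
Definition adr (x y : L) : L := bracket y x.

HB.instance Definition _ (x : L) :=
  GRing.isLinear.Build F L L *:%R (adl x) (@bracket_linearr F L x).
HB.instance Definition _ (x : L) :=
  GRing.isLinear.Build F L L *:%R (adr x) (@bracket_linearl F L x).

(** In the Leibniz identity for x, x, y the term [x, [x, y]] occurs on both sides and cancels. *)
Lemma bracket_square_left (x y : L) : bracket (bracket x x) y = 0.
Proof.
have := bracket_leibniz x x y.
by rewrite -[LHS]add0r => /addIr.
Qed.

Lemma mem_derived (x y : L) : bracket x y \in derived L.
Proof. by rewrite memv_bracket ?memvf. Qed.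

(** The hypothesis puts [L, L] in the kernel of every left multiplication, so L^(2) = 0. *)
Lemma nilpotent_of_bracket_derived :
  (forall x y z : L, bracket x (bracket y z) = 0) -> is_nilpotent L.
Proof.
move=> br0; exists 2%N; apply/eqP; rewrite -subv0.
apply/bracketvP => x u _ Lu; rewrite memv0.
have sK : (derived L <= lker (linfun (adl x)))%VS.
  by apply/bracketvP => y w _ _; rewrite memv_ker lfunE /= /adl br0.
by have := subvP sK _ Lu; rewrite memv_ker lfunE.
Qed.

Lemma rank_one_bracket :
    ~ is_nilpotent L -> ~ is_lie L -> \dim (derived L) = 1%N ->
  exists z e : L, exists a c : {scalar L},
    [/\ forall x y, bracket x y = (a x * c y) *: z,
        a z = 0, c z = 1, a e = 1 & c e = 0].
Proof.
move=> nnil nlie dim1.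
set z := vpick (derived L).
have z0 : z != 0 by rewrite vpick0 -dimv_eq0 dim1.
have derE : derived L = <[z]>%VS.
  apply/eqP; rewrite eq_sym eqEdim dim_vline z0 dim1 andbT.
  by rewrite -memvE memv_pick.
have freez : free [tuple z] by rewrite seq1_free.
(* A linear form on all of L that reads off the coefficient of z on the line [L, L]; thus phi(x, y)
   is [p (bracket x y)]. *)
pose p : {scalar L} := coord [tuple z] ord0.
have pK v : v \in derived L -> v = p v *: z.
  rewrite derE => /vlineP[k ->].
  by rewrite linearZ /= (coord_free ord0 ord0 freez) eqxx mulr1.
have brE x y : bracket x y = p (bracket x y) *: z by rewrite -pK ?mem_derived.
have bz y : bracket z y = 0.
  apply/eqP/negPn/negP => bzy; apply: nlie => x; apply/eqP.
  have := bracket_square_left x y; rewrite (brE x x) linearZl_LR /= => /eqP.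
  by rewrite scaler_eq0 (negPf bzy) orbF => /eqP->; rewrite scale0r.
(* Compare coefficients of z in the Leibniz identity for x, y, w; the term [[x, y], w] is a multiple
   of [z, w] = 0. *)
have phiE x y w :
    p (bracket x z) * p (bracket y w) = p (bracket y z) * p (bracket x w).
  have /(congr1 p) := bracket_leibniz x y w.
  rewrite (brE x y) linearZl_LR /= bz scaler0 add0r {1}(brE y w) {1}(brE x w).
  by rewrite !linearZr_LR !linearZ /= mulrC [RHS]mulrC.
pose a : {scalar L} := p \o adr z.
have [e ae] : exists e, a e != 0.
  (* If [-, z] vanished, so would every [x, [y, w]], since [y, w] is a multiple of z. *)
  have [s0|] := boolP (fullv <= lker (linfun (adr z)))%VS.
    case: nnil; apply: nilpotent_of_bracket_derived => x y w.
    have := subvP s0 x (memvf x); rewrite memv_ker lfunE /= /adr => /eqP xz0.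
    by rewrite (brE y w) linearZr_LR /= xz0 scaler0.
  case/subvPn => e _; rewrite memv_ker lfunE /= /adr => ez0; exists e.
  apply: contra_neq ez0; rewrite /a /= /adr => pez0.
  by rewrite brE [X in X *: _]pez0 scale0r.
have [e1 ae1] : exists e1, a e1 = 1.
  by exists ((a e)^-1 *: e); rewrite linearZ /= mulVf.
(* As phi(e1, z) = 1, [phiE] with x = e1 gives phi(y, w) = a(y) c(w). *)
pose c : {scalar L} := p \o adl e1.
have cz : c z = 1 by [].
have az : a z = 0 by rewrite /a /= /adr bz linear0.
(* Subtracting c(e1) z kills the value of c and keeps a = 1, because c(z) = 1 and a(z) = 0. *)
exists z, (e1 - c e1 *: z), a, c; split=> //.
- move=> x y; rewrite brE; congr (_ *: _).
  by rewrite -[LHS]mul1r -ae1 phiE.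
- by rewrite linearB linearZ ae1 az /= mulr0 subr0.
- by rewrite linearB linearZ cz /= mulr1 subrr.
Qed.

Lemma rank_one_bracket_isomorphic (z e : L) (a c : {scalar L}) :
    (forall x y, bracket x y = (a x * c y) *: z) ->
    a z = 0 -> c z = 1 -> a e = 1 -> c e = 0 ->
  exists A : leibnizType F,
    [/\ is_abelian A, \dim {:A} = (\dim {:L} - 2)%N
      & leibniz_isomorphic L (S2 F * A)%type].
Proof.
move=> brE az cz ae ce.
pose g (x : L) : S2 F := c x *: S2_e1 F + a x *: S2_e2 F.
have g0 x : (g x : 'rV_2) 0 0 = c x.
  by rewrite /g !mxE /= mulr1 mulr0 addr0.
have g1 x : (g x : 'rV_2) 0 1 = a x.
  by rewrite /g !mxE /= mulr1 mulr0 add0r.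
have g_lin : linear g.
  by move=> k x y; rewrite /g scalerDr !scalerA !linearP /= !scalerDl addrACA.
pose gL : {linear L -> S2 F} := HB.pack g (GRing.isLinear.Build _ _ _ _ g g_lin).
(* A linear section of [g], with image the span of z and e; hence L is the direct sum of that span
   and ker [g]. *)
pose h (s : S2 F) : L := (s : 'rV_2) 0 0 *: z + (s : 'rV_2) 0 1 *: e.
have gh s : g (h s) = s.
  apply/rowP => i; case: (unliftP 0 i) => [j|] ->; last first.
    by rewrite g0 /h linearD !linearZ /= cz ce mulr1 mulr0 addr0.
  rewrite [j]ord1 (_ : lift _ _ = 1); last exact: val_inj.
  by rewrite g1 /h linearD !linearZ /= az ae mulr1 mulr0 add0r.
have h_lin : linear h.
  by move=> k x y; rewrite /h !mxE !scalerDl !scalerDr !scalerA addrACA.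
pose K := lker (linfun gL).
have KP x : reflect (g x = 0) (x \in K).
  by rewrite memv_ker lfunE; apply: eqP.
have hK x : x - h (g x) \in K.
  by apply/KP; rewrite -[g _]/(gL _) linearB /= gh subrr.
(* By [hK] the vector x - h(g x) is already in [K], so [vsproj] only changes its type. *)
pose f x : (S2 F * abelian_on (subvs_of K))%type := (g x, vsproj K (x - h (g x))).
have f_lin : linear f.
  move=> k x y; rewrite /f g_lin h_lin; congr (_, _).
  transitivity (k *: vsproj K (x - h (g x)) + vsproj K (y - h (g y))) => //.
  by rewrite -linearP scalerBr opprD addrACA.
have gz : g z = S2_e1 F by rewrite /g cz az scale1r scale0r addr0.
have hz : h (S2_e1 F) = z by rewrite /h !mxE /= scale1r scale0r addr0.
pose fL : {linear L -> (S2 F * abelian_on (subvs_of K))%type} :=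
  HB.pack f (GRing.isLinear.Build _ _ _ _ f f_lin).
exists (abelian_on (subvs_of K)); split; first exact: abelian_onP.
  have g_full : limg (linfun gL) = fullv.
    apply/eqP; rewrite eqEsubv subvf; apply/subvP => s _.
    by rewrite -(gh s) -[g _]/(gL _) -lfunE memv_img ?memvf.
  (* Rank-nullity gives dim K + 2 = dim L, so the natural-number subtraction is not truncated. *)
  have := limg_ker_dim (linfun gL) fullv.
  rewrite g_full capfv -/K [\dim {:S2 F}]dimvf => <-.
  by rewrite [RHS]addnK [LHS]dimvf.
exists fL; split=> /=.
  exists (fun u => h u.1 + vsval (u.2 : subvs_of K)) => [x|[s k]] /=.
    by rewrite vsprojK // addrC subrK.
  have gk : g (vsval k) = 0 by apply/KP/subvsP.
  have gs : g (h s + vsval k) = s by rewrite -[g _]/(gL _) linearD /= gk addr0 gh.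
  by rewrite /f gs addrC addKr vsvalK.
(* Every bracket is a multiple of z, and z = h(g z) has no component in [K]. *)
have f_brk x y : f ((a x * c y) *: z) = ((a x * c y) *: S2_e1 F, 0).
  rewrite -[f _]/(fL _) linearZ /= /f gz hz subrr.
  by congr (_, _); rewrite [X in _ *: X]linear0 scaler0.
move=> x y; rewrite brE f_brk; congr (_, _).
by rewrite /bracket /= /S2_bracket g0 g1.
Qed.

End LeibnizTheory.

Theorem theorem2p2 (F : fieldType) (char_neq2 : 2%N \notin [pchar F])
    (n : nat) (L : leibnizType F) (dimL : \dim {:L} = n)
    (L_not_nilpotent : ~ is_nilpotent L) (L_not_lie : ~ is_lie L)
    (dim_derived : \dim (derived L) = 1%N) :
  exists A : leibnizType F,
    [/\ is_abelian A, \dim {:A} = (n - 2)%N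
      & leibniz_isomorphic L (S2 F * A)%type].
Proof.
have [z [e [a [c [brE az cz ae ce]]]]] :=
  rank_one_bracket L_not_nilpotent L_not_lie dim_derived.
by rewrite -dimL; apply: rank_one_bracket_isomorphic brE az cz ae ce.
Qed.
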